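(* Let $P,Q$ be probability measures on $(\Omega,\mathcal{M})$. For measurable $\rho:\Omega\to[0,\infty]$ and $\beta\ne0$ let $\mathcal{T}^+_\beta(\rho)=\{\tau:\Omega\to[0,\infty]\text{ measurable}: E_P[\tau^\beta]\le E_P[\rho^\beta]\}$ and $\mathcal{T}^-_\beta(\rho)=\{\tau:\Omega\to[0,\infty]\text{ measurable}: E_P[\tau^\beta]\ge E_P[\rho^\beta]\}$. (1) Suppose $Q\ll P$, $\nu>0$, and $\phi_\nu=(dQ/dP)^\nu$. Then $$\sup_{\tau\in\mathcal{T}^+_{1+\nu^{-1}}(\phi_\nu)}\log\int\tau dQ=\log\int\phi_\nu dQ=\inf_{c>1}\Big\{\frac1c\log\int\phi_\nu^cdP+\frac1{c-1}R_{c/(c-1)}(Q\|P)\Big\},$$ the infimum is achieved at $c=1+\nu^{-1}$, and $\log\int\phi_\nu dQ=\nu(1+\nu)R_{1+\nu}(Q\|P)$. (2) Suppose $P\ll Q$, $\nu>1$, $\rho_\nu=(dP/dQ)^\nu$, and $\int(dP/dQ)^{\nu-1}dP<\infty$. Then $$\inf_{\tau\in\mathcal{T}^-_{1-\nu^{-1}}(\rho_\nu)}\log\int\tau dQ=\log\int\rho_\nu dQ=\sup_{c<1,c\ne0}\Big\{\frac1c\log\int\rho_\nu^cdP-\frac1{1-c}R_{1/(1-c)}(P\|Q)\Big\},$$ the supremum is achieved at $c=1-\nu^{-1}$, and $\log\int\rho_\nu dQ=\nu(\nu-1)R_\nu(P\|Q)$. (3) Suppose $P\ll Q$, $\nu\in(0,1)$,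 $\rho_\nu=(dP/dQ)^\nu$. Then $$\inf_{\tau\in\mathcal{T}^+_{1-\nu^{-1}}(\rho_\nu)}\log\int\tau dQ=\log\int\rho_\nu dQ=\sup_{c<1,c\ne0}\Big\{\frac1c\log\int\rho_\nu^cdP-\frac1{1-c}R_{1/(1-c)}(P\|Q)\Big\},$$ the supremum is achieved at $c=1-\nu^{-1}$, and $\log\int\rho_\nu dQ=\nu(\nu-1)R_\nu(P\|Q)$.
   Context: Powers $\tau^c=\exp(c\log\tau)$ with continuous extensions of $\exp,\log$ to extended reals; conventions $-\infty+\infty=\infty$ in upper bounds and $\infty-\infty=-\infty$ in lower bounds. Rényi divergence: let $\nu'$ be a $\sigma$-finite positive measure with $dP=p\,d\nu'$, $dQ=q\,d\nu'$. For $\alpha\in(0,1)$, $R_\alpha(Q\|P)=\frac{1}{\alpha(\alpha-1)}\log\int_{p>0}q^\alpha p^{1-\alpha}\,d\nu'$; for $\alpha>1$, the same formula if $Q\ll P$ and $R_\alpha(Q\|P)=+\infty$ if $Q\not\ll P$; for $\alpha<0$, $R_\alpha(Q\|P)=R_{1-\alpha}(P\|Q)$. *)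

(* Defs.v *)
From HB Require Import structures.
From mathcomp Require Import all_boot all_order all_algebra.
From mathcomp Require Import all_classical all_reals all_analysis.
From mathcomp Require Import measurable_realfun.
Set Implicit Arguments. Unset Strict Implicit. Unset Printing Implicit Defensive.
Import Order.TTheory GRing.Theory Num.Theory.
Local Open Scope classical_set_scope.
Local Open Scope ring_scope.
Local Open Scope ereal_scope.

Section defs.
Context {R : realType}.

(* continuous extension of log to [0, +oo]  (log 0 = -oo, log +oo = +oo);
   only used on nonnegative arguments *)
Definition elog (x : \bar R) : \bar R :=
  match x with
  | r%:E => if (0 < r)%R then (ln r)%:E else -oo
  | +oo => +oo
  | -oo => -oo
  end.

Definition eexp (x : \bar R) : \bar R :=
  match x with
  | r%:E => (expR r)%:E
  | +oo => +oo
  | -oo => 0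
  end.

Definition epow (t : \bar R) (c : R) : \bar R := eexp (c%:E * elog t).

Context {d : measure_display} {T : measurableType d}.

Definition is_density (mu Q : set T -> \bar R) (f : T -> \bar R) : Prop :=
  measurable_fun setT f /\ (forall x, 0 <= f x) /\
  (forall A, measurable A -> Q A = \int[mu]_(x in A) f x).

Definition renyi_int (mu : set T -> \bar R) (q p : T -> \bar R) (a : R) : \bar R :=
  \int[mu]_(x in [set x | 0 < p x]) (epow (q x) a * epow (p x) (1 - a)).

(* R_a(Q||P) for a in (0,1) or a > 1, where q = dQ/dmu, p = dP/dmu *)
Definition renyi_pos (mu Q P : set T -> \bar R) (q p : T -> \bar R) (a : R) : \bar R :=
  if ((0 < a) && (a < 1))%R then
    ((a * (a - 1))^-1)%:E * elog (renyi_int mu q p a)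
  else if (1 < a)%R then
    (if `[< Q `<< P >] then ((a * (a - 1))^-1)%:E * elog (renyi_int mu q p a)
     else +oo)
  else 0 (* a in {0, 1}: not defined in the paper, not used *).

(* Renyi divergence R_a(Q||P) computed with a reference measure mu,
   q = dQ/dmu, p = dP/dmu; for a < 0, R_a(Q||P) = R_{1-a}(P||Q). *)
Definition renyi (mu Q P : set T -> \bar R) (q p : T -> \bar R) (a : R) : \bar R :=
  if (a < 0)%R then renyi_pos mu P Q p q (1 - a) else renyi_pos mu Q P q p a.

Definition Tplus (P : set T -> \bar R) (b : R) (rho : T -> \bar R) :
    set (T -> \bar R) :=
  [set tau | measurable_fun setT tau /\ (forall x, 0 <= tau x) /\
     \int[P]_x epow (tau x) b <= \int[P]_x epow (rho x) b].

Definition Tminus (P : set T -> \bar R) (b : R) (rho : T -> \bar R) :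
    set (T -> \bar R) :=
  [set tau | measurable_fun setT tau /\ (forall x, 0 <= tau x) /\
     \int[P]_x epow (tau x) b >= \int[P]_x epow (rho x) b].

End defs.

(* Main.v *)
Require Import Defs.
From HB Require Import structures.
From mathcomp Require Import all_boot all_order all_algebra.
From mathcomp Require Import all_classical all_reals all_analysis.
From mathcomp Require Import measurable_realfun.
From mathcomp Require Import ring lra.
Import Order.TTheory GRing.Theory Num.Theory.
Local Open Scope classical_set_scope.
Local Open Scope ring_scope.
Local Open Scope ereal_scope.

(** Changing variables turns [\int h dQ] into [\int h (dQ/dP) dP], so every bound
    below is an instance of one inequality,
      [log \int w <= a log \int u + (1 - a) log \int v   if   w <= u^a v^(1-a)],
    with [0 < a < 1].
    - [w = tau f], [u = tau^c], [v = f^(c/(c-1))], [a = 1/c] gives the upper bound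
      of part (1);
    - [w = tau^c g], [u = tau], [v = g^(1/(1-c))], [a = c] gives the lower bound of
      parts (2) and (3) for [0 < c < 1];
    - [w = g^(1/(1-c))], [u = tau^c g], [v = tau], [a = 1/(1-c)] gives it for
      [c < 0].
    Equality holds when [u] and [v] are proportional, which for a power of the
    density pins down [c] in terms of [nu]; the two terms of the bound are then
    multiples of the same quantity [log \int (dQ/dP)^(1+nu) dP] (resp.
    [log \int (dP/dQ)^nu dQ]) with coefficients adding up to [1]. *)

(** * Logarithm and powers on [[0, +oo]], and a pointwise Young inequality *)

Section extended_log.
Context {R : realType}.
Implicit Types (x y t : \bar R) (a b c : R).

Lemma elogE : @elog R = @lne R.
Proof. by apply/funext => -[r| |]//=; rewrite leNgt; case: (0 < r)%R. Qed.

Lemma eexpE : @eexp R = @expeR R.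
Proof. by apply/funext => -[]. Qed.

Lemma elogK t : 0 <= t -> eexp (elog t) = t.
Proof.
by move=> t0; rewrite eexpE elogE; apply: lneK; rewrite in_itv/= t0 leey.
Qed.

Lemma eexpK x : elog (eexp x) = x.
Proof. by rewrite eexpE elogE expeRK. Qed.

Lemma elog_epow t c : elog (epow t c) = c%:E * elog t.
Proof. exact: eexpK. Qed.

Lemma epow_ge0 t c : 0 <= epow t c.
Proof. by rewrite /epow eexpE expeR_ge0. Qed.

Lemma le_elog x y : 0 <= x -> x <= y -> elog x <= elog y.
Proof.
move=> x0 xy; rewrite elogE lee_lne// in_itv/= ?x0 ?leey//.
by rewrite (le_trans x0 xy).
Qed.

Lemma elog1 : elog 1 = 0 :> \bar R.
Proof. by rewrite elogE lne1. Qed.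

Lemma elog_eqNy x : 0 <= x -> elog x = -oo -> x = 0.
Proof. by move=> x0 xNy; rewrite -(elogK _ x0) xNy. Qed.

Lemma epow1 t : 0 <= t -> epow t 1 = t.
Proof. by move=> t0; rewrite /epow mul1e elogK. Qed.

Lemma one_epow c : epow 1 c = 1 :> \bar R.
Proof. by rewrite /epow elog1 mule0 /= expR0. Qed.

Lemma epowM t a b : epow (epow t a) b = epow t (a * b).
Proof. by rewrite {1}/epow elog_epow muleA -EFinM mulrC. Qed.

(** At [t = 0] with [a < 0] the product is [+oo * 0 = 0], which agrees with [0^(a + 1)] because
    [a + 1 > 0]. At [t = +oo] with [-1 < a < 0] the two sides would be [0] and [+oo]. *)
Lemma epow_mulr_self t a : 0 <= t < +oo -> (0 < a + 1)%R ->
  epow t a * t = epow t (a + 1).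
Proof.
case: t => [r| |]; rewrite ?ltxx ?andbF// ltry andbT lee_fin le_eqVlt.
case/predU1P => [<- a1|r0 a1].
  by rewrite mule0 /epow /= ltxx gt0_muleNy ?lte_fin.
rewrite /epow /= r0 -!EFinM /= mulrDl mul1r expRD lnK//.
Qed.

Lemma measurable_elog : measurable_fun [set: \bar R] (@elog R).
Proof.
rewrite (_ : @elog R = fun x => if x \is a fin_num then
    (if (0 < fine x)%R then (ln (fine x))%:E else -oo) else x); last first.
  by apply/funext => -[].
apply: measurable_fun_ifT => //=.
  by apply: (measurable_fun_bool true); exact/emeasurable_fin_num.
apply: measurable_fun_ifT => //=.
  exact: measurable_fun_ltr.
apply/measurable_EFinP; apply: measurableT_comp => //.
Qed.

Lemma measurable_eexp : measurable_fun [set: \bar R] (@eexp R).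
Proof.
rewrite (_ : @eexp R = fun x => if x \is a fin_num then
    (expR (fine x))%:E else if x == +oo then +oo else 0); last first.
  by apply/funext => -[].
apply: measurable_fun_ifT => //=.
- by apply: (measurable_fun_bool true); exact/emeasurable_fin_num.
- by apply/measurable_EFinP; apply: measurableT_comp.
- by apply: measurable_fun_ifT => //=; exact: measurable_fun_eqe.
Qed.

Lemma measurable_epow c : measurable_fun [set: \bar R] (epow ^~ c).
Proof.
apply: (measurableT_comp measurable_eexp).
exact/measurable_funeM/measurable_elog.
Qed.

Lemma measurable_epow_comp {d : measure_display} {T : measurableType d}
    (h : T -> \bar R) c : measurable_fun setT h ->
  measurable_fun setT (fun z => epow (h z) c).
Proof. by move=> mh; exact: (measurableT_comp (measurable_epow c)). Qed.

Lemma dual_adde0 x : dual_adde x 0 = x.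
Proof. by case: x => *; rewrite /dual_adde /= ?addr0. Qed.

(** Equality fails at [0 * +oo = 0]: its logarithm is [-oo], whereas [dual_adde] reads [-oo + oo] as
    [+oo]. *)
Lemma elogM_le x y : 0 <= x -> 0 <= y ->
  elog (x * y) <= dual_adde (elog x) (elog y).
Proof.
rewrite le_eqVlt => /predU1P[<- _|x0]; first by rewrite mul0e /= ltxx leNye.
rewrite le_eqVlt => /predU1P[<-|y0]; first by rewrite mule0 /= ltxx leNye.
rewrite elogE lneM ?in_itv/= ?leey ?x0 ?y0//.
by case: (lne x) (lne y) => [?||] [?||].
Qed.

(* The log-sum-exp form of Young's inequality, with the scales [s] and [t] left
   free so that it can be integrated and then optimized. *)
Lemma young_le a (s t : R) (u v w : \bar R) : (0 < a < 1)%R ->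
  0 <= u -> 0 <= v -> 0 <= w ->
  elog w <= dual_adde (a%:E * elog u) ((1 - a)%:E * elog v) ->
  w <= (expR (a * s + (1 - a) * t))%:E *
       ((a * expR (- s))%:E * u + ((1 - a) * expR (- t))%:E * v).
Proof.
move=> /andP[a0 a1]; have b0 : (0 < 1 - a)%R by lra.
have as0 := mulr_gt0 a0 (expR_gt0 (- s)).
have bt0 := mulr_gt0 b0 (expR_gt0 (- t)).
have K0 := expR_gt0 (a * s + (1 - a) * t).
case: u => [u| |]//; last first.
  move=> _ v0 _ _; rewrite gt0_muley ?lte_fin// addye.
    by rewrite gt0_muley ?lte_fin// leey.
  by rewrite gt_eqF// (lt_le_trans _ (mule_ge0 _ v0))// ?ltNy0// lee_fin ltW.
case: v => [v| |]//; last first.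
  move=> u0 _ _ _; rewrite [X in _ + X]gt0_muley ?lte_fin// addey.
    by rewrite gt0_muley ?lte_fin// leey.
  by rewrite gt_eqF// (lt_le_trans _ (mule_ge0 _ u0))// ?ltNy0// lee_fin ltW.
move=> u0 v0 w0.
have rhs0 : 0 <= (expR (a * s + (1 - a) * t))%:E *
       ((a * expR (- s))%:E * u%:E + ((1 - a) * expR (- t))%:E * v%:E).
  apply: mule_ge0; first by rewrite lee_fin ltW.
  by apply: adde_ge0; apply: mule_ge0 => //; rewrite lee_fin ltW.
have wNy : elog w <= -oo -> w <= (expR (a * s + (1 - a) * t))%:E *
       ((a * expR (- s))%:E * u%:E + ((1 - a) * expR (- t))%:E * v%:E).
  by rewrite leeNy_eq => /eqP/(elog_eqNy _ w0) ->.
rewrite /=; case: ltP => [ug|_]; last first.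
  by rewrite gt0_muleNy ?lte_fin//; case: ifP => _ /=; rewrite ?gt0_muleNy ?lte_fin.
case: ltP => [vg|_]; last by rewrite [_ * -oo]gt0_muleNy ?lte_fin.
case: w w0 wNy => [w| |]// w0 wNy /=.
case: ltP => [wg|]; last first.
  by rewrite le_eqVlt ltNge -lee_fin w0 orbF => /eqP ->.
rewrite -!EFinM /dual_adde /= !lee_fin => h.
rewrite -(lnK wg) -(lnK ug) -(lnK vg).
apply: (@le_trans _ _ (expR (a * ln u + (1 - a) * ln v))%R).
  by rewrite ler_expR.
set m := (a * s + (1 - a) * t)%R; set M := (a * ln u + (1 - a) * ln v)%R.
have -> : expR M = (expR m * expR (M - m))%R by rewrite -expRD subrKC.
rewrite ler_pM2l ?expR_gt0// -!mulrA -!expRD.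
(* Tangent-line bounds for [expR], shifted by [M - m] so that the linear terms cancel when averaged
   with weights [a] and [1 - a]. *)
have h1 := expR_ge1Dx (- s + ln u - (M - m)).
have h2 := expR_ge1Dx (- t + ln v - (M - m)).
have e (r : R) : expR r = (expR (M - m) * expR (r - (M - m)))%R.
  by rewrite -expRD subrKC.
rewrite (e (- s + _)%R) (e (- t + _)%R) !(mulrCA _ (expR (M - m))) -mulrDr.
rewrite ler_peMr ?expR_ge0//.
have := lerD (ler_wpM2l (ltW a0) h1) (ler_wpM2l (ltW b0) h2).
apply: le_trans; rewrite /M /m; lra.
Qed.

End extended_log.

(** * Hölder's inequality in logarithmic form *)

Section log_hoelder.
Context {R : realType} {d : measure_display} {T : measurableType d}.
Variable mu : {measure set T -> \bar R}.

Lemma integral_young_le (a s t : R) (u v w : T -> \bar R) : (0 < a < 1)%R ->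
  measurable_fun setT u -> measurable_fun setT v -> measurable_fun setT w ->
  (forall x, 0 <= u x) -> (forall x, 0 <= v x) -> (forall x, 0 <= w x) ->
  (forall x, elog (w x) <=
     dual_adde (a%:E * elog (u x)) ((1 - a)%:E * elog (v x))) ->
  \int[mu]_x w x <= (expR (a * s + (1 - a) * t))%:E *
    ((a * expR (- s))%:E * \int[mu]_x u x +
     ((1 - a) * expR (- t))%:E * \int[mu]_x v x).
Proof.
move=> a01 mu_ mv mw u0 v0 w0 h.
have /andP[a0 a1] := a01.
have as0 : (0 <= a * expR (- s))%R by rewrite mulr_ge0 ?expR_ge0 ?ltW.
have bt0 : (0 <= (1 - a) * expR (- t))%R.
  by rewrite mulr_ge0 ?expR_ge0// subr_ge0 ltW.
have U0 x : 0 <= (a * expR (- s))%:E * u x by rewrite mule_ge0 ?lee_fin.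
have V0 x : 0 <= ((1 - a) * expR (- t))%:E * v x by rewrite mule_ge0 ?lee_fin.
have mU := measurable_funeM (a * expR (- s))%:E mu_.
have mV := measurable_funeM ((1 - a) * expR (- t))%:E mv.
rewrite -!ge0_integralZl_EFin// -ge0_integralD// -ge0_integralZl_EFin//.
- apply: ge0_le_integral => //.
  + by apply/measurable_funeM/emeasurable_funD.
  + by move=> x _; exact: young_le.
- by move=> x _; rewrite adde_ge0.
- exact: emeasurable_funD.
Qed.

(* The pointwise bound is taken in the logarithm
   with the convention [-oo + oo = +oo], so that [u^a v^(1-a)] is read as [+oo]
   where the usual convention [0 * oo = 0] would give [0]; the inequality survives
   because the exceptional sets only matter when an integral on the right is [+oo]. *)
Lemma log_hoelder (a : R) (u v w : T -> \bar R) : (0 < a < 1)%R ->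
  measurable_fun setT u -> measurable_fun setT v -> measurable_fun setT w ->
  (forall x, 0 <= u x) -> (forall x, 0 <= v x) -> (forall x, 0 <= w x) ->
  (forall x, elog (w x) <=
     dual_adde (a%:E * elog (u x)) ((1 - a)%:E * elog (v x))) ->
  elog (\int[mu]_x w x) <=
    dual_adde (a%:E * elog (\int[mu]_x u x)) ((1 - a)%:E * elog (\int[mu]_x v x)).
Proof.
move=> a01 mu_ mv mw u0 v0 w0 h.
have /andP[a0 a1] := a01; have b0 : (0 < 1 - a)%R by rewrite subr_gt0.
have Y s t := @integral_young_le a s t u v w a01 mu_ mv mw u0 v0 w0 h.
have: 0 <= \int[mu]_x u x by exact: integral_ge0.
have: 0 <= \int[mu]_x v x by exact: integral_ge0.
have: 0 <= \int[mu]_x w x by exact: integral_ge0.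
move: Y; set W := \int[mu]_x w x.
case: (\int[mu]_x u x) => [A| |]//; last first.
  by move=> *; rewrite gt0_muley ?lte_fin//= leey.
case: (\int[mu]_x v x) => [B| |]//; last first.
  by move=> *; rewrite [X in dual_adde _ X]gt0_muley ?lte_fin//; case: (_ * _) => *;
     rewrite leey.
move=> Y; rewrite !lee_fin => W0 B0 A0.
(* If one of the two integrals vanishes, its scale can be sent to [-oo], which forces [W = 0]. *)
have shrink (k C : R) : (0 < k)%R -> (0 <= C)%R ->
    (forall s, W <= (expR (k * s) * C)%:E) -> W = 0.
  move=> k0 C0 WC; apply/eqP; rewrite eq_le W0 andbT.
  apply/lee_addgt0Pr => e e0; rewrite add0e.
  apply: (le_trans (WC (ln (e / (C + 1)) / k)%R)).
  have C1 : (0 < C + 1)%R by lra.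
  rewrite lee_fin (mulrC k) divfK ?gt_eqF// lnK ?posrE ?divr_gt0//.
  by rewrite -mulrA ger_pMr// mulrC ler_pdivrMr// mul1r lerDl.
have [A0'|A0'] := ltP 0%R A; last first.
  have AE : A = 0%R by apply/eqP; rewrite eq_le A0' A0.
  suff -> : W = 0 by rewrite /= ltxx leNye.
  apply: (shrink a ((1 - a) * B)%R a0) => [|s]; first by rewrite mulr_ge0// ltW.
  apply: (le_trans (Y s 0%R)); rewrite AE -!EFinM.
  by rewrite lee_fin !mulr0 oppr0 expR0 addr0 add0r mulr1.
have [B0'|B0'] := ltP 0%R B; last first.
  have BE : B = 0%R by apply/eqP; rewrite eq_le B0' B0.
  suff -> : W = 0 by rewrite /= ltxx leNye.
  apply: (shrink (1 - a)%R (a * A)%R b0) => [|s]; first by rewrite mulr_ge0// ltW.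
  apply: (le_trans (Y 0%R s)); rewrite BE -!EFinM.
  by rewrite lee_fin !mulr0 oppr0 expR0 addr0 add0r mulr1.
(* The scales [ln A] and [ln B] normalize both integrals to [1], so the bracket becomes
   [a + (1 - a) = 1]. *)
have : W <= (expR (a * ln A + (1 - a) * ln B))%:E.
  apply: (le_trans (Y (ln A) (ln B))); rewrite -!EFinM lee_fin.
  rewrite !expRN !lnK ?posrE// !mulfVK ?gt_eqF// subrKC mulr1//.
move=> /(le_elog _ _ W0)/le_trans; apply.
by rewrite /= expR_gt0 expRK A0' B0'.
Qed.

End log_hoelder.

(** * Change of measure and moments of a density *)

Section density.
Context {R : realType} {d : measure_display} {T : measurableType d}.
Variables (P Q : probability T R) (f : T -> \bar R).
Hypotheses (QP : Q `<< P) (dens : is_density P Q f).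

Let mf : measurable_fun setT f. Proof. by have [] := dens. Qed.
Let f0 x : 0 <= f x. Proof. by have [_ []] := dens. Qed.

Lemma integral_density : \int[P]_x f x = 1.
Proof. by have [_ [_ <-//]] := dens; rewrite probability_setT. Qed.

Lemma integrable_density : P.-integrable setT f.
Proof.
apply/integrableP; split => //.
by under eq_integral do rewrite gee0_abs//; rewrite integral_density ltry.
Qed.

(** Change of variables holds for the Radon-Nikodym derivative, and [f] agrees with it [P]-almost
    everywhere since both integrate to [Q] on every measurable set. *)
Lemma integral_density_mul (h : T -> \bar R) : (forall x, 0 <= h x) ->
  measurable_fun setT h -> \int[Q]_x h x = \int[P]_x (h x * f x).
Proof.
move=> h0 mh.
rewrite -(Radon_Nikodym_SigmaFinite.change_of_variables QP)//.
have iRN := Radon_Nikodym_SigmaFinite.f_integrable QP.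
have mRN := measurable_int _ iRN.
apply: ae_eq_integral => //; [exact: emeasurable_funM..|].
apply: (filterS _ (integral_ae_eq measurableT iRN mf _)).
  by move=> x /= e _; rewrite e.
move=> E _ mE; rewrite -Radon_Nikodym_SigmaFinite.f_integral//.
by have [_ [_ dE]] := dens; exact: dE.
Qed.

(** Having integral [1], [f] is finite [P]-almost everywhere, so [f^a * f = f^(a + 1)] there, even
    for negative [a]. *)
Lemma integral_epow_density (a : R) : (0 < a + 1)%R ->
  \int[Q]_x epow (f x) a = \int[P]_x epow (f x) (a + 1).
Proof.
move=> a1; rewrite integral_density_mul; last 2 first.
- by move=> x; exact: epow_ge0.
- exact: measurable_epow_comp.
apply: ae_eq_integral => //.
- by apply: emeasurable_funM => //; exact: measurable_epow_comp.
- exact: measurable_epow_comp.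
apply: (filterS _ (integrable_ae measurableT integrable_density)).
move=> x /= fin _; rewrite epow_mulr_self// f0/=.
by rewrite ltey_eq fin.
Qed.

(** A zero moment would give [f^a = 0], hence [f = (f^a)^(1/a) = 0], almost everywhere, against
    [\int f dP = 1]. *)
Lemma elog_integral_epow_density_gtNy (a : R) : (0 < a)%R ->
  -oo < elog (\int[P]_x epow (f x) a).
Proof.
move=> a0; rewrite ltNye; apply/eqP => /elog_eqNy.
move=> /(_ (integral_ge0 _ (fun x _ => epow_ge0 _ _))) I0.
have mfa := measurable_epow_comp _ a mf.
have : ae_eq P setT (fun x => epow (f x) a) (cst 0).
  apply/ae_eq_integral_abs => //.
  by under eq_integral do rewrite gee0_abs ?epow_ge0//.
move=> fa0.
have : \int[P]_x f x = \int[P]_x (cst 0 x).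
  apply: ae_eq_integral => //; apply: (filterS _ fa0) => x /= /(_ I) e _.
  have : epow (epow (f x) a) a^-1 = f x by rewrite epowM divff ?gt_eqF// epow1.
  by rewrite e => <-; rewrite /epow /= ltxx gt0_muleNy// lte_fin invr_gt0.
by rewrite integral_density integral0 => /eqP; rewrite onee_eq0.
Qed.

(** Jensen's inequality for a concave power, read off from Hölder with [u = f] and [v = 1], both of
    integral [1]. *)
Lemma elog_integral_epow_density_le0 (a : R) : (0 < a < 1)%R ->
  elog (\int[P]_x epow (f x) a) <= 0.
Proof.
move=> a01.
have := @log_hoelder _ _ _ P a f (cst 1) (fun x => epow (f x) a) a01 mf.
have P1 : \int[P]_x cst 1 x = 1 :> \bar R.
  by rewrite integral_cst// mul1e; exact: probability_setT.
rewrite integral_density P1 elog1 !mule0 dual_adde0.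
apply => //.
- exact: measurable_epow_comp.
- by move=> x; exact: epow_ge0.
- by move=> x; rewrite elog_epow dual_adde0.
Qed.

End density.

(** * Bounds on the objective for a fixed exponent [c] *)

Section variational.
Context {R : realType} {d : measure_display} {T : measurableType d}.
Variables (P Q : probability T R) (f : T -> \bar R).
Hypotheses (QP : Q `<< P) (dens : is_density P Q f).

Let mf : measurable_fun setT f. Proof. by have [] := dens. Qed.
Let f0 x : 0 <= f x. Proof. by have [_ []] := dens. Qed.

(** With [P] itself as reference measure its density is [1], so the domain [p > 0] is the whole
    space, and [Q << P] excludes the [+oo] branch. *)
Lemma renyi_density (a : R) : (0 < a)%R -> a != 1%R ->
  renyi P Q P f (cst 1) a = ((a * (a - 1))^-1)%:E * elog (\int[P]_x epow (f x) a).
Proof.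
move=> a0 a1.
have -> : \int[P]_x epow (f x) a = renyi_int P f (cst 1) a.
  rewrite /renyi_int (_ : [set x | _] = setT); last first.
    by apply/seteqP; split => x //= _; exact: lte01.
  by apply: eq_integral => x _; rewrite one_epow mule1.
rewrite /renyi ltNge ltW//= /renyi_pos a0 /=.
case: ltgtP a1 => //= _ _.
by rewrite asboolT.
Qed.

Lemma elog_integral_upper (tau : T -> \bar R) (c : R) : (1 < c)%R ->
  measurable_fun setT tau -> (forall x, 0 <= tau x) ->
  elog (\int[Q]_x tau x) <=
    dual_adde ((c^-1)%:E * elog (\int[P]_x epow (tau x) c))
              ((1 - c^-1)%:E * elog (\int[P]_x epow (f x) (c / (c - 1)))).
Proof.
move=> c1 mtau tau0; rewrite (integral_density_mul _ _ _ QP dens)//.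
apply: log_hoelder.
- by rewrite invr_gt0 invf_lt1; lra.
- exact: measurable_epow_comp.
- exact: measurable_epow_comp.
- exact: emeasurable_funM.
- by move=> x; exact: epow_ge0.
- by move=> x; exact: epow_ge0.
- by move=> x; rewrite mule_ge0.
move=> x; rewrite !elog_epow !muleA -!EFinM mulVf ?mul1e; last by lra.
rewrite (_ : ((1 - c^-1) * (c / (c - 1)) = 1)%R) ?mul1e; last first.
  by field; lra.
exact: elogM_le.
Qed.

(** In the lower bounds [P] carries the objective and [Q] the constraint, so the two measures are
    exchanged relative to parts (2) and (3). *)
Lemma elog_integral_lower_pos (tau : T -> \bar R) (c : R) : (0 < c < 1)%R ->
  measurable_fun setT tau -> (forall x, 0 <= tau x) ->
  elog (\int[Q]_x epow (tau x) c) <=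
    dual_adde (c%:E * elog (\int[P]_x tau x))
              ((1 - c)%:E * elog (\int[P]_x epow (f x) (1 - c)^-1)).
Proof.
move=> c01 mtau tau0; rewrite (integral_density_mul _ _ _ QP dens)//; last 2 first.
- by move=> x; exact: epow_ge0.
- exact: measurable_epow_comp.
apply: log_hoelder => //.
- exact: measurable_epow_comp.
- by apply: emeasurable_funM => //; exact: measurable_epow_comp.
- by move=> x; exact: epow_ge0.
- by move=> x; rewrite mule_ge0// epow_ge0.
move=> x; apply: (le_trans (elogM_le _ _ (epow_ge0 _ _) (f0 x))).
by rewrite !elog_epow !muleA -!EFinM mulfV ?mul1e//; lra.
Qed.

(** A reverse Hölder inequality: the moment of the density is what gets bounded, and the powers of
    [tau] cancel since [c/(1-c) + (1 - 1/(1-c)) = 0]. *)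
Lemma elog_integral_lower_neg (tau : T -> \bar R) (c : R) : (c < 0)%R ->
  measurable_fun setT tau -> (forall x, 0 <= tau x) ->
  elog (\int[P]_x epow (f x) (1 - c)^-1) <=
    dual_adde (((1 - c)^-1)%:E * elog (\int[Q]_x epow (tau x) c))
              ((1 - (1 - c)^-1)%:E * elog (\int[P]_x tau x)).
Proof.
move=> c0 mtau tau0.
have a0 : (0 < (1 - c)^-1)%R by rewrite invr_gt0; lra.
have a1 : ((1 - c)^-1 < 1)%R by rewrite invf_lt1; lra.
have b0 : (0 < 1 - (1 - c)^-1)%R by lra.
rewrite (integral_density_mul _ _ _ QP dens)//; last 2 first.
- by move=> x; exact: epow_ge0.
- exact: measurable_epow_comp.
apply: log_hoelder => //.
- by rewrite a0.
- by apply: emeasurable_funM => //; exact: measurable_epow_comp.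
- exact: measurable_epow_comp.
- by move=> x; rewrite mule_ge0// epow_ge0.
- by move=> x; exact: epow_ge0.
move=> x; rewrite elog_epow.
have := f0 x; rewrite le_eqVlt => /predU1P[<-|fx0].
  by rewrite /= ltxx gt0_muleNy ?lte_fin// leNye.
have lM y : 0 < y -> elog (y * f x) = elog y + elog (f x).
  by move=> y0; rewrite elogE lneM// in_itv/= leey ?y0 ?fx0.
have fNy : elog (f x) != -oo.
  by apply/eqP => /(elog_eqNy _ (f0 x)) fx; rewrite fx ltxx in fx0.
case: (tau x) (tau0 x) => [r| |]// r0; last first.
  by rewrite [X in dual_adde _ X]gt0_muley ?lte_fin//; case: (_ * elog (_ * f x)) => *;
     rewrite leey.
have [r1|r1] := ltP 0%R r; last first.
  (* Where [tau] vanishes its negative power is [+oo], which prevails over [elog 0 = -oo] in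
     [dual_adde]. *)
  rewrite (_ : epow r%:E c = +oo); last by rewrite /epow /= ltNge r1/= lt0_muleNy.
  by rewrite lM// [elog +oo]/= addye// gt0_muley ?lte_fin// leey.
rewrite lM; last by rewrite /epow /= r1 lte_fin expR_gt0.
rewrite elog_epow /= r1.
case: (elog (f x)) fNy => [l| |]// _; last first.
  by rewrite addey// gt0_muley ?lte_fin//= leey.
rewrite /dual_adde /= lee_fin le_eqVlt; apply/orP; left; apply/eqP; field; lra.
Qed.

(** Solves the two preceding bounds for [\int tau dP]. For [c < 0] the order [1/(1-c)] is below [1]
    and the log-moment of [f] is finite; for [c > 0] it may be [+oo], and then the lower bound is
    [-oo]. *)
Lemma elog_integral_lower (tau : T -> \bar R) (c : R) : (c < 1)%R -> c <> 0%R ->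
  measurable_fun setT tau -> (forall x, 0 <= tau x) ->
  (c^-1)%:E * elog (\int[Q]_x epow (tau x) c)
    - ((1 - c) / c)%:E * elog (\int[P]_x epow (f x) (1 - c)^-1)
  <= elog (\int[P]_x tau x).
Proof.
move=> c1 /eqP cn0 mtau tau0.
have a0 : (0 < (1 - c)^-1)%R by rewrite invr_gt0; lra.
have LNy := elog_integral_epow_density_gtNy _ _ _ dens _ a0.
case: (ltgtP c 0%R) cn0 => // c0 _.
- have a1 : ((1 - c)^-1 < 1)%R by rewrite invf_lt1; lra.
  have b0 : (0 < 1 - (1 - c)^-1)%R by lra.
  have a01 : (0 < (1 - c)^-1 < 1)%R by rewrite a0.
  have Ly := elog_integral_epow_density_le0 _ _ _ dens _ a01.
  move: (elog_integral_lower_neg tau c c0 mtau tau0) LNy Ly.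
  case: (elog (\int[P]_x epow (f x) _)) => [l3| |]// + _ _.
  case: (elog (\int[Q]_x epow (tau x) c)) => [l2| |]/=.
  + case: (elog (\int[P]_x tau x)) => [l1| |]/=.
    * rewrite /dual_adde /= -!EFinM -EFinB !lee_fin => h.
      have c' : (0 < - c)%R by lra.
      rewrite -(ler_pM2l c') -subr_ge0.
      (* Scaled by [- c > 0], the claim is [1 - c] times the slack in the Hölder bound. *)
      have -> : (- c * l1 - - c * (c^-1 * l2 - (1 - c) / c * l3) =
        (1 - c) * ((1 - c)^-1 * l2 + (1 - (1 - c)^-1) * l1 - l3))%R by field; lra.
      by apply: mulr_ge0; lra.
    * by rewrite leey.
    * by rewrite [X in dual_adde _ X]gt0_muleNy ?lte_fin.
  + by move=> _; rewrite lt0_muley ?lte_fin ?invr_lt0// leNye.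
  + rewrite gt0_muleNy ?lte_fin//.
    case: (elog (\int[P]_x tau x)) => [l1| |]//; first by rewrite leey.
    by rewrite [X in dual_adde _ X]gt0_muleNy ?lte_fin.
- have c01 : (0 < c < 1)%R by rewrite c0.
  have bc : (0 < (1 - c) / c)%R by rewrite divr_gt0//; lra.
  have b0 : (0 < 1 - c)%R by lra.
  have ci : (0 < c^-1)%R by rewrite invr_gt0.
  move: (elog_integral_lower_pos tau c c01 mtau tau0) LNy.
  case: (elog (\int[P]_x epow (f x) _)) => [l3| |]//; last first.
    by rewrite [in X in _ - X]gt0_muley ?lte_fin//= addeNy leNye.
  case: (elog (\int[P]_x tau x)) => [l1| |]/=; last 2 first.
  + by rewrite leey.
  + rewrite gt0_muleNy ?lte_fin// leeNy_eq => /eqP -> _.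
    by rewrite gt0_muleNy ?lte_fin.
  case: (elog (\int[Q]_x epow (tau x) c)) => [l2| |]//=; last first.
    by move=> _ _; rewrite gt0_muleNy ?lte_fin// addNye leNye.
  rewrite /dual_adde /= -!EFinM -EFinB !lee_fin => h _.
  rewrite -(ler_pM2l c0) -subr_ge0.
  have -> : (c * l1 - c * (c^-1 * l2 - (1 - c) / c * l3) =
    c * l1 + (1 - c) * l3 - l2)%R by field; lra.
  lra.
Qed.

End variational.

(** * Extrema attained by a member of the set *)

Section attainment.
Context {R : realType}.

Lemma ereal_sup_attained (S : set (\bar R)) (m : \bar R) :
  S m -> (forall x, S x -> x <= m) -> ereal_sup S = m.
Proof.
move=> Sm ub; apply/eqP; rewrite eq_le ereal_sup_ubound// andbT.
exact: ge_ereal_sup.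
Qed.

Lemma ereal_inf_attained (S : set (\bar R)) (m : \bar R) :
  S m -> (forall x, S x -> m <= x) -> ereal_inf S = m.
Proof.
move=> Sm lb; apply/eqP; rewrite eq_le ereal_inf_lbound//=.
exact: le_ereal_inf_tmp.
Qed.

End attainment.

(** * Optimality of powers of the density *)

Section optimality.
Context {R : realType} {d : measure_display} {T : measurableType d}.
Variables (P Q : probability T R) (f : T -> \bar R) (nu : R).
Hypotheses (QP : Q `<< P) (dens : is_density P Q f) (nu_gt0 : (0 < nu)%R).

Let mf : measurable_fun setT f. Proof. by have [] := dens. Qed.

Let phi := fun x => epow (f x) nu.

Let mphi : measurable_fun setT phi. Proof. exact: measurable_epow_comp. Qed.
Let phi0 x : 0 <= phi x. Proof. exact: epow_ge0. Qed.

(** The Hölder bound at the fixed exponent [1 + nu^-1], over all admissible [tau], gives the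
    supremum; for the fixed function [phi], over all [c], it gives the infimum. Both meet at
    [F (1 + nu^-1)]. *)
Lemma upper_optimal :
  let F := fun c : R =>
    dual_adde ((c^-1)%:E * elog (\int[P]_x epow (phi x) c))
              (((c - 1)^-1)%:E * renyi P Q P f (cst 1) (c / (c - 1))) in
  [/\ ereal_sup [set elog (\int[Q]_x tau x) | tau in Tplus P (1 + nu^-1) phi]
        = elog (\int[Q]_x phi x),
      ereal_inf [set F c | c in [set c : R | (1 < c)%R]]
        = elog (\int[Q]_x phi x),
      F (1 + nu^-1)%R = elog (\int[Q]_x phi x) &
      elog (\int[Q]_x phi x) = (nu * (1 + nu))%:E * renyi P Q P f (cst 1) (1 + nu)].
Proof.
move=> F; have nu0 := nu_gt0.
have i0 : (0 < nu^-1)%R by rewrite invr_gt0.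
(* For [a = c/(c-1)] one has [a(a-1) = c/(c-1)^2], so the log-moment inside the Rényi term gets
   weight [1 - 1/c]. *)
have FE c : (1 < c)%R -> F c = dual_adde ((c^-1)%:E * elog (\int[P]_x epow (phi x) c))
    ((1 - c^-1)%:E * elog (\int[P]_x epow (f x) (c / (c - 1)))).
  move=> c1; rewrite /F (renyi_density _ _ _ QP); last 2 first.
  - by rewrite divr_gt0; lra.
  - by apply/eqP => /(congr1 (fun r => r * (c - 1))%R); rewrite divfK; lra.
  by rewrite muleA -EFinM; congr (dual_adde _ (_%:E * _)); field; lra.
have IE : \int[Q]_x phi x = \int[P]_x epow (f x) (1 + nu).
  rewrite [(1 + nu)%R]addrC.
  by apply: (integral_epow_density _ _ _ QP dens); rewrite addr_gt0.
have powE : \int[P]_x epow (phi x) (1 + nu^-1) = \int[P]_x epow (f x) (1 + nu).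
  by apply: eq_integral => x _; rewrite epowM; congr epow; field; lra.
have conjE : ((1 + nu^-1) / (1 + nu^-1 - 1) = 1 + nu)%R by field; lra.
(* At the optimal [c] both terms contain the same [L], possibly infinite, with positive weights of
   sum [1]. *)
have opt (L : \bar R) : dual_adde (((1 + nu^-1)^-1)%:E * L)
    ((1 - (1 + nu^-1)^-1)%:E * L) = L.
  have p0 : (0 < (1 + nu^-1)^-1)%R by rewrite invr_gt0; lra.
  have p1 : (0 < 1 - (1 + nu^-1)^-1)%R by rewrite subr_gt0 invf_lt1; lra.
  case: L => [l| |].
  - by rewrite /dual_adde /=; congr EFin; field; lra.
  - by rewrite !gt0_muley ?lte_fin.
  - by rewrite !gt0_muleNy ?lte_fin.
have Fopt : F (1 + nu^-1)%R = elog (\int[Q]_x phi x).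
  by rewrite FE ?powE ?conjE ?IE ?opt//; lra.
have bound tau c : (1 < c)%R -> measurable_fun setT tau -> (forall x, 0 <= tau x) ->
    elog (\int[Q]_x tau x) <= _ := @elog_integral_upper R d T P Q f QP dens tau c.
split => //.
- apply: ereal_sup_attained; first by exists phi.
  move=> _ [tau [mtau [tau0 le_tau]] <-].
  have c1 : (1 < 1 + nu^-1)%R by lra.
  apply: (le_trans (bound tau _ c1 mtau tau0)).
  rewrite -Fopt FE//.
  set K := (_ * elog (\int[P]_x epow (f x) _)).
  have : ((1 + nu^-1)^-1)%:E * elog (\int[P]_x epow (tau x) (1 + nu^-1)) <=
         ((1 + nu^-1)^-1)%:E * elog (\int[P]_x epow (phi x) (1 + nu^-1)).
    rewrite lee_wpmul2l ?lee_fin ?invr_ge0//; first by lra.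
    by apply: le_elog => //; apply: integral_ge0 => x _; exact: epow_ge0.
  exact: DualAddTheoryRealDomain.lee_dD2r.
- apply: ereal_inf_attained.
    by exists (1 + nu^-1)%R => //=; lra.
  by move=> _ [c c1 <-]; rewrite FE//; exact: bound.
- rewrite IE (renyi_density _ _ _ QP); [|lra..].
  rewrite muleA -EFinM (_ : (_ * _ = 1)%R) ?mul1e//; field; lra.
Qed.

(* [S] stands for [Tminus] if [nu > 1] and for [Tplus] if [nu < 1]: the sign of
   [1 - nu^-1] makes the two constraints the same condition on logarithms. *)
Lemma lower_optimal (S : set (T -> \bar R)) : nu != 1%R ->
  elog (\int[P]_x epow (f x) nu) \is a fin_num ->
  S phi ->
  (forall tau, S tau -> [/\ measurable_fun setT tau, forall x, 0 <= tau x &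
    ((1 - nu^-1)^-1)%:E * elog (\int[Q]_x epow (phi x) (1 - nu^-1)) <=
    ((1 - nu^-1)^-1)%:E * elog (\int[Q]_x epow (tau x) (1 - nu^-1))]) ->
  let G := fun c : R =>
    (c^-1)%:E * elog (\int[Q]_x epow (phi x) c)
    - ((1 - c)^-1)%:E * renyi P Q P f (cst 1) ((1 - c)^-1) in
  [/\ ereal_inf [set elog (\int[P]_x tau x) | tau in S] = elog (\int[P]_x phi x),
      ereal_sup [set G c | c in [set c : R | (c < 1)%R /\ c <> 0%R]]
        = elog (\int[P]_x phi x),
      G (1 - nu^-1)%R = elog (\int[P]_x phi x) &
      elog (\int[P]_x phi x) = (nu * (nu - 1))%:E * renyi P Q P f (cst 1) nu].
Proof.
move=> nu1 Lfin Sphi Sle G; have nu0 := nu_gt0.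
have i0 : (0 < nu^-1)%R by rewrite invr_gt0.
have nuB1 : (nu - 1 != 0)%R by rewrite subr_eq0.
have c1 : (1 - nu^-1 < 1)%R by lra.
have c0 : (1 - nu^-1 <> 0)%R.
  by move/eqP; rewrite subr_eq0 eq_sym invr_eq1 (negPf nu1).
have GE c : (c < 1)%R -> c <> 0%R -> G c = (c^-1)%:E * elog (\int[Q]_x epow (phi x) c)
    - ((1 - c) / c)%:E * elog (\int[P]_x epow (f x) (1 - c)^-1).
  move=> lt_c1 /eqP c_neq0; rewrite /G (renyi_density _ _ _ QP); last 2 first.
  - by rewrite invr_gt0; lra.
  - by rewrite invr_eq1 subr_eq -subr_eq0 opprD addNKr oppr_eq0.
  rewrite muleA -EFinM; congr (_ - (_%:E * _)); field; lra.
have conjE : ((1 - (1 - nu^-1))^-1 = nu)%R by rewrite subKr invrK.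
(* Here [phi^(1 - 1/nu) = f^(nu - 1)], and passing from [Q] to [P] supplies the missing factor
   [f]. *)
have powE : \int[Q]_x epow (phi x) (1 - nu^-1) = \int[P]_x phi x.
  transitivity (\int[Q]_x epow (f x) (nu - 1)).
    by apply: eq_integral => x _; rewrite epowM; congr epow; field; lra.
  by rewrite (integral_epow_density _ _ _ QP dens) subrK.
(* The weights [nu/(nu-1)] and [-1/(nu-1)] have opposite signs; finiteness of the log-moment rules
   out [oo - oo]. *)
have Gopt : G (1 - nu^-1)%R = elog (\int[P]_x phi x).
  rewrite GE// powE conjE; move: Lfin; rewrite -/phi.
  case: (elog (\int[P]_x phi x)) => // l _.
  rewrite -!EFinM -EFinB; congr EFin; field.
  by rewrite gt_eqF.
have bound tau c : (c < 1)%R -> c <> 0%R -> measurable_fun setT tau ->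
    (forall x, 0 <= tau x) -> _ <= elog (\int[P]_x tau x) :=
  @elog_integral_lower R d T P Q f QP dens tau c.
split => //.
- apply: ereal_inf_attained; first by exists phi.
  move=> _ [tau /Sle[mtau tau0 le_tau] <-].
  apply: le_trans (bound tau _ c1 c0 mtau tau0).
  by rewrite -Gopt GE// leeD2r.
- apply: ereal_sup_attained; first by exists (1 - nu^-1)%R.
  by move=> _ [c [lt_c1 c_neq0] <-]; rewrite GE//; exact: bound.
- rewrite (renyi_density _ _ _ QP)//.
  by rewrite muleA -EFinM mulfV ?mul1e// mulf_neq0// gt_eqF.
Qed.

End optimality.

(** * The three variational formulas for [P] and [Q] *)

Theorem mainTheorem14 (R : realType) (d : measure_display) (T : measurableType d)
    (P Q : probability T R) :
  (* (1) *)
  (forall (nu : R) (f : T -> \bar R),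
     Q `<< P -> (0 < nu)%R -> is_density P Q f ->
     let phi := fun x => epow (f x) nu in
     let F := fun c : R =>
       dual_adde ((c^-1)%:E * elog (\int[P]_x epow (phi x) c))
                 (((c - 1)^-1)%:E * renyi P Q P f (cst 1) (c / (c - 1))) in
     [/\ ereal_sup [set elog (\int[Q]_x tau x) | tau in Tplus P (1 + nu^-1) phi]
           = elog (\int[Q]_x phi x),
         ereal_inf [set F c | c in [set c : R | (1 < c)%R]]
           = elog (\int[Q]_x phi x),
         F (1 + nu^-1)%R = elog (\int[Q]_x phi x) &
         elog (\int[Q]_x phi x) = (nu * (1 + nu))%:E * renyi P Q P f (cst 1) (1 + nu)]) /\
  (* (2) *)
  (forall (nu : R) (g : T -> \bar R),
     P `<< Q -> (1 < nu)%R -> is_density Q P g ->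
     \int[P]_x epow (g x) (nu - 1) < +oo ->
     let rho := fun x => epow (g x) nu in
     let G := fun c : R =>
       (c^-1)%:E * elog (\int[P]_x epow (rho x) c)
       - ((1 - c)^-1)%:E * renyi Q P Q g (cst 1) ((1 - c)^-1) in
     [/\ ereal_inf [set elog (\int[Q]_x tau x) | tau in Tminus P (1 - nu^-1) rho]
           = elog (\int[Q]_x rho x),
         ereal_sup [set G c | c in [set c : R | (c < 1)%R /\ c <> 0%R]]
           = elog (\int[Q]_x rho x),
         G (1 - nu^-1)%R = elog (\int[Q]_x rho x) &
         elog (\int[Q]_x rho x) = (nu * (nu - 1))%:E * renyi Q P Q g (cst 1) nu]) /\
  (* (3) *)
  (forall (nu : R) (g : T -> \bar R),
     P `<< Q -> (0 < nu)%R -> (nu < 1)%R -> is_density Q P g ->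
     let rho := fun x => epow (g x) nu in
     let G := fun c : R =>
       (c^-1)%:E * elog (\int[P]_x epow (rho x) c)
       - ((1 - c)^-1)%:E * renyi Q P Q g (cst 1) ((1 - c)^-1) in
     [/\ ereal_inf [set elog (\int[Q]_x tau x) | tau in Tplus P (1 - nu^-1) rho]
           = elog (\int[Q]_x rho x),
         ereal_sup [set G c | c in [set c : R | (c < 1)%R /\ c <> 0%R]]
           = elog (\int[Q]_x rho x),
         G (1 - nu^-1)%R = elog (\int[Q]_x rho x) &
         elog (\int[Q]_x rho x) = (nu * (nu - 1))%:E * renyi Q P Q g (cst 1) nu]).
Proof.
split; [|split].
- by move=> nu f QP nu0 dens; exact: upper_optimal.
- move=> nu g PQ nu1 dens gfin rho.
  have nu0 : (0 < nu)%R by lra.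
  have mg : measurable_fun setT g by have [] := dens.
  apply: lower_optimal => //.
  + by rewrite gt_eqF.
  (* The integrability assumption says exactly that [\int g^nu dQ] is finite. *)
  + rewrite fin_numE -ltNye (elog_integral_epow_density_gtNy _ _ _ dens)//=.
    move: gfin; rewrite (integral_epow_density _ _ _ PQ dens) subrK//.
    by case: (\int[Q]_x _) => [r| |]//= _; case: ifP.
  + split; first exact: measurable_epow_comp.
    by split => // x; exact: epow_ge0.
  + move=> tau [mtau [tau0 le_tau]]; split => //.
    have c0 : (0 <= (1 - nu^-1)^-1)%R.
      by rewrite invr_ge0 subr_ge0 invf_le1; lra.
    rewrite lee_wpmul2l ?lee_fin//.
    by apply: le_elog => //; apply: integral_ge0 => x _; exact: epow_ge0.
- move=> nu g PQ nu0 nu1 dens rho.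
  have mg : measurable_fun setT g by have [] := dens.
  apply: lower_optimal => //.
  + by rewrite lt_eqF.
  (* For [nu < 1] the Jensen bound provides finiteness. *)
  + rewrite fin_numE -ltNye (elog_integral_epow_density_gtNy _ _ _ dens)//=.
    rewrite -ltey (le_lt_trans (elog_integral_epow_density_le0 _ _ _ dens _ _))//.
    by rewrite nu0.
  + split; first exact: measurable_epow_comp.
    by split => // x; exact: epow_ge0.
  + move=> tau [mtau [tau0 le_tau]]; split => //.
    (* The negative factor reverses the inequality that defines [Tplus]. *)
    have c0 : ((1 - nu^-1)^-1 <= 0)%R.
      by rewrite invr_le0 subr_le0 invf_ge1// ltW.
    rewrite -leeN2 -!mulNe -EFinN lee_wpmul2l ?lee_fin ?oppr_ge0//.
    by apply: le_elog => //; apply: integral_ge0 => x _; exact: epow_ge0.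
Qed.
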